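(* Let $L$ be a Lie algebra over a field, graded by a group $(G,\ast)$: $L=\bigoplus_{g\in G}L_g$ with $[L_g,L_h]\subseteq L_{g\ast h}$ for all $g,h\in G$. Let $X=\{g\in G : L_g\neq\{0\}\}$ be the support of the grading, assumed non-empty. If $X$ is arithmetically-free, then $L$ is nilpotent of class at most $H(|X|)$.
   Context: $\mathbb{N}=\{1,2,3,\dots\}$. Arithmetically-free: a subset $X$ of an abelian group $(G,+)$ is arithmetically-free iff $X$ is finite and for all $x,g\in X$ the set $\mathcal{O}(x,g)=\{x,x+g,x+2g,x+3g,\dots\}$ is not contained in $X$. A subset $X$ of an arbitrary group $(G,\ast)$ is arithmetically-free iff $X$ is finite and every subset $Z$ of $X$ consisting of pairwise commuting elements is an arithmetically-free subset of the abelian subgroup generated by $Z$ (that is, for all $x,g\in Z$ the set $\{x,\,x\ast g,\,x\ast g\ast g,\,\dots\}$ is not contained in $Z$). Generalised Higman map: put $f(\alpha,\lambda)=\lambda\cdot\alpha^{\lambda}$ for $\alpha,\lambda\in\mathbb{N}$. For $a,b,c\in\mathbb{N}$ define $H_a(b,c)\in\mathbb{N}$ by $H_a(1,c)=1$ for all $c\ge 1$, $H_a(b,1)=a$ for all $b>1$, and for $b,c>1$ $$H_a(b,c)=\max\Big\{a\cdot f\big(c,\;a+H_a\big(b-1,\;a\cdot f(c-1,H_a(b,c-1))\big)+1\big),\;H_a(b-1,c),\;H_a(b,c-1)\Big\}.$$ Then $H(n)=H_n(n,n)$ for $n\in\mathbb{N}$. *)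

(* Defs.v *)
From HB Require Import structures.
From mathcomp Require Import all_boot all_algebra finmap.
From mathcomp Require Import boolp classical_sets functions cardinality.

Set Implicit Arguments.
Unset Strict Implicit.
Unset Printing Implicit Defensive.

Import GRing.Theory.
Local Open Scope classical_set_scope.
Local Open Scope ring_scope.

HB.mixin Record Lmodule_isLieAlgebra (K : fieldType) (L : Type)
    of GRing.Lmodule K L := {
  bracket : L -> L -> L;
  bracket_linearl : forall y : L, linear (fun x : L => bracket x y);
  bracket_linearr : forall x : L, linear (bracket x);
  bracketxx : forall x : L, bracket x x = 0;
  bracket_jacobi : forall x y z : L,
    bracket x (bracket y z) + bracket y (bracket z x)
      + bracket z (bracket x y) = 0 }.

#[short(type="lieAlgType")]
HB.structure Definition LieAlgebra (K : fieldType) :=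
  {L of GRing.Lmodule K L & Lmodule_isLieAlgebra K L}.

Definition subspace (K : fieldType) (L : lmodType K) (V : set L) : Prop :=
  submod_closed [in V].

(* [lower_central L n] is the (n+1)-st term of the usual lower central series,
   so that [lower_central L 0] is L and class at most c means that
   [lower_central L c] vanishes. *)
Fixpoint lower_central (K : fieldType) (L : lieAlgType K) (n : nat) : set L :=
  if n is m.+1 then
    smallest (@subspace K L)
      [set bracket x y | x in @lower_central K L m & y in [set: L]]
  else [set: L].
Arguments lower_central {K} L n.

Definition nilpotent_class_le (K : fieldType) (L : lieAlgType K) (c : nat) :
  Prop := lower_central L c = [set 0].

(* The direct sum condition is the existence and uniqueness, for every x, of a
   finitely supported family of components of x. *)
Definition is_grading (K : fieldType) (L : lieAlgType K) (G : groupType)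
    (L_ : G -> set L) : Prop :=
  [/\ forall g, subspace (L_ g),
      forall x : L, exists! f : {fsfun G -> L with 0},
        (forall g, L_ g (f g)) /\ x = \sum_(g <- finsupp f) f g &
      forall g h x y, L_ g x -> L_ h y -> L_ (g * h)%g (bracket x y)].

Definition grading_support (K : fieldType) (L : lieAlgType K) (G : groupType)
    (L_ : G -> set L) : set G := [set g | L_ g <> [set 0]].

Definition progression (G : groupType) (x g : G) : set G :=
  range (fun k : nat => (x * g ^+ k)%g).

(* To be used for sets Z of pairwise commuting elements: all progressions then
   stay inside the abelian subgroup generated by Z, so that it does not matter
   whether Z is seen in that subgroup or in G. *)
Definition abelian_arithmetically_free (G : groupType) (Z : set G) : Prop :=
  finite_set Z /\ forall x g, Z x -> Z g -> ~ (progression x g `<=` Z).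

Definition arithmetically_free (G : groupType) (X : set G) : Prop :=
  finite_set X /\
  forall Z : set G, Z `<=` X -> (forall x y, Z x -> Z y -> commute x y) ->
    abelian_arithmetically_free Z.

Definition higman_f (alpha lambda : nat) : nat := (lambda * alpha ^ lambda)%N.

(* The arguments a, b, c are positive; the values at b = 0 or c = 0 are junk
   and are never reached from positive arguments. *)
Fixpoint higman3 (a b : nat) {struct b} : nat -> nat :=
  match b with
  | 0 => fun=> 0
  | 1 => fun=> 1
  | b'.+1 => fix row (c : nat) : nat :=
      match c with
      | 0 => 0
      | 1 => a
      | c'.+1 =>
          maxn (maxn
            (a * higman_f c
                   (a + higman3 a b' (a * higman_f c' (row c')) + 1))
            (higman3 a b' c))
            (row c')
      end
  end%N.

Definition higman (n : nat) : nat := higman3 n n n.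

Lemma higman3_1l (a c : nat) : higman3 a 1 c = 1.
Proof. by []. Qed.

Lemma higman3_1r (a b : nat) : (1 < b)%N -> higman3 a b 1 = a.
Proof. by case: b => [|[|b]]. Qed.

Lemma higman3_rec (a b c : nat) : (1 < b)%N -> (1 < c)%N ->
  higman3 a b c =
  maxn (maxn
    (a * higman_f c
       (a + higman3 a (b - 1) (a * higman_f (c - 1) (higman3 a b (c - 1))) + 1))
    (higman3 a (b - 1) c))
    (higman3 a b (c - 1)).
Proof. by case: b => [|[|b]] // _; case: c => [|[|c]] // _; rewrite !subn1. Qed.

(* Main.v *)
Require Import Defs.
From mathcomp Require Import all_boot all_algebra finmap.
From mathcomp Require Import boolp classical_sets functions cardinality.
From mathcomp Require Import zify.

(* Lie subalgebras are encoded by their families of homogeneous components.  An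
   element of the derived algebra having weight d is a sum of words [..., y] whose
   last letter does not have weight d, because 1 is not in X.  Fix Y in X and let D
   be the complement of Y.  If, for every d in D, passing to the derived algebra
   of the subalgebra generated by the components of weight in Y + d is done often
   enough, the last letters of an element of weight in D may all be taken of
   weight in Y, as many as we like.  When the components of weight in Y generate
   a solvable subalgebra R, this R acts nilpotently, since n = |X| elements of one
   component already act as 0 (X is arithmetically-free) and on the sections of
   the action of R' the algebra R acts by commuting operators.  So the result of
   this descent lies in R and is solvable, and induction on |D| bounds the derived
   length of L, hence its nilpotency class.  It starts from Y = {y}, where R is
   nilpotent.  The nested iterations match those in the definition of H. *)

Set Implicit Arguments.
Unset Strict Implicit.
Unset Printing Implicit Defensive.

Local Open Scope classical_set_scope.

(** * Subspaces and linear spans *)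

Section Span.
Local Open Scope ring_scope.
Import GRing.Theory.
Context {K : fieldType} {L : lmodType K}.
Implicit Types (V W S : set L).

Lemma subspaceP V :
  subspace V <-> V 0 /\ forall a x y, V x -> V y -> V (a *: x + y).
Proof.
split=> [[]|[V0 VD]].
  rewrite inE => V0 VD; split=> // a x y Vx Vy.
  by have := VD a x y; rewrite !inE; apply.
by split=> [|a x y]; rewrite !inE //; apply: VD.
Qed.

Definition span S : set L := smallest (@subspace K L) S.

Lemma sub_span S : S `<=` span S.
Proof. exact: sub_gen_smallest. Qed.

Lemma span_min S V : subspace V -> S `<=` V -> span S `<=` V.
Proof. exact: smallest_sub. Qed.

Lemma subspace_span S : subspace (span S).
Proof.
apply/subspaceP; split=> [M [/subspaceP[]]//|a x y Sx Sy M MS].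
by case: (MS) => /subspaceP[_ MD] _; apply: MD; [apply: Sx|apply: Sy].
Qed.

Lemma subspace0 V : subspace V -> V 0.
Proof. by case/subspaceP. Qed.

Lemma subspaceD V x y : subspace V -> V x -> V y -> V (x + y).
Proof. by case/subspaceP=> _ VD Vx Vy; rewrite -[x]scale1r; apply: VD. Qed.

Lemma subspaceN V x : subspace V -> V x -> V (- x).
Proof.
by case/subspaceP=> V0 VD Vx; rewrite -scaleN1r -[_ *: _]addr0; apply: VD.
Qed.

Lemma subspaceB V x y : subspace V -> V x -> V y -> V (x - y).
Proof. by move=> sV Vx Vy; apply: subspaceD => //; apply: subspaceN. Qed.

Lemma subspace_set0 : subspace [set (0 : L)].
Proof.
by apply/subspaceP; split=> // a x y /= -> ->; rewrite scaler0 addr0.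
Qed.

End Span.

(** * Bracket identities, left-normed words and iterated brackets *)

Section Bracket.
Local Open Scope ring_scope.
Import GRing.Theory.
Context {K : fieldType} {L : lieAlgType K}.
Implicit Types (x y z u v w : L) (V W P : set L).

Lemma bracketPl a x y z :
  bracket (a *: x + y) z = a *: bracket x z + bracket y z.
Proof. exact: (bracket_linearl z). Qed.

Lemma bracketPr a x y z :
  bracket z (a *: x + y) = a *: bracket z x + bracket z y.
Proof. exact: (bracket_linearr z). Qed.

Lemma bracketDl x y z : bracket (x + y) z = bracket x z + bracket y z.
Proof. by have := bracketPl 1 x y z; rewrite !scale1r. Qed.

Lemma bracketDr x y z : bracket z (x + y) = bracket z x + bracket z y.
Proof. by have := bracketPr 1 x y z; rewrite !scale1r. Qed.

Lemma bracket0l x : bracket 0 x = 0.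
Proof. by apply: (addrI (bracket 0 x)); rewrite -bracketDl !addr0. Qed.

Lemma bracket0r x : bracket x 0 = 0.
Proof. by apply: (addrI (bracket x 0)); rewrite -bracketDr !addr0. Qed.

Lemma bracketC x y : bracket x y = - bracket y x.
Proof.
apply/eqP; rewrite -addr_eq0; apply/eqP.
have := bracketxx (x + y).
by rewrite bracketDl !bracketDr !bracketxx add0r addr0.
Qed.

Lemma bracketNr x y : bracket x (- y) = - bracket x y.
Proof. by apply/eqP; rewrite -addr_eq0 -bracketDr addNr bracket0r. Qed.

Lemma bracketA u v x :
  bracket u (bracket v x) = bracket (bracket u v) x - bracket (bracket u x) v.
Proof.
have /eqP := bracket_jacobi u v x; rewrite -addrA addr_eq0 => /eqP ->.
by rewrite (bracketC x (bracket u v)) (bracketC x u) bracketNr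
  (bracketC v (bracket u x)) opprK opprD opprK addrC.
Qed.

Lemma bracketAC u v x :
  bracket (bracket u v) x = bracket (bracket u x) v + bracket u (bracket v x).
Proof. by rewrite bracketA addrC subrK. Qed.

Definition word (w : L) (s : seq L) : L := foldl bracket w s.

Lemma word0 s : word 0 s = 0.
Proof. by elim: s => //= y s IH; rewrite bracket0l. Qed.

Lemma word_linear s : linear (word^~ s).
Proof.
elim: s => //= y s IH a u v.
by rewrite bracketPl IH.
Qed.

Lemma wordB s u v : word (u - v) s = word u s - word v s.
Proof. by rewrite -scaleN1r addrC word_linear scaleN1r addrC. Qed.

Lemma word_cat w s t : word w (s ++ t) = word (word w s) t.
Proof. exact: foldl_cat. Qed.

Lemma subspace_preword s V : subspace V -> subspace [set w | V (word w s)].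
Proof.
move=> /subspaceP[V0 VD]; apply/subspaceP; split=> [|a x y Vx Vy] /=.
  by rewrite word0.
by rewrite word_linear; apply: VD.
Qed.

Lemma subspace_prebracketl y V : subspace V -> subspace [set w | V (bracket w y)].
Proof. exact: (subspace_preword [:: y]). Qed.

Lemma subspace_prebracketr y V : subspace V -> subspace [set w | V (bracket y w)].
Proof.
move=> /subspaceP[V0 VD]; apply/subspaceP; split=> [|a u v Vu Vv] /=.
  by rewrite bracket0r.
by rewrite bracketPr; apply: VD.
Qed.

Definition brset W P : set L := span [set bracket w x | w in W & x in P].

Lemma subspace_brset W P : subspace (brset W P).
Proof. exact: subspace_span. Qed.

Lemma mem_brset W P w x : W w -> P x -> brset W P (bracket w x).
Proof. by move=> Ww Px; apply: sub_span; exists w => //; exists x. Qed.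

Lemma brset_min W P V : subspace V ->
  (forall w x, W w -> P x -> V (bracket w x)) -> brset W P `<=` V.
Proof.
by move=> sV WPV; apply: span_min => // _ [w Ww [x Px <-]]; apply: WPV.
Qed.

(** The iterated product [V, P, ..., P] with [k] factors [P]. Nilpotent action of [P] on the whole
    algebra is expressed as the vanishing of some [chain P k setT]. *)
Definition chain P (k : nat) V : set L := iter k (brset^~ P) V.

Lemma chain_sub P k V W : V `<=` W -> chain P k V `<=` chain P k W.
Proof.
move=> VW; elim: k => //= k IH; apply: brset_min; first exact: subspace_brset.
by move=> w x /IH Ww Px; apply: mem_brset.
Qed.

Lemma chain_le P k m : (k <= m)%N -> chain P m setT `<=` chain P k setT.
Proof.
move=> /subnK <-; rewrite addnC /chain iterD; exact: chain_sub.
Qed.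

Lemma chain_words P k V W : subspace W ->
  (forall w s, V w -> size s = k -> {in s, forall y, P y} -> W (word w s)) ->
  chain P k V `<=` W.
Proof.
move=> sW; elim: k V => [|k IH] V VW; first by move=> w Vw; apply: (VW w [::]).
rewrite /chain iterSr; apply: IH => w s + sk Ps.
apply: (@brset_min V P [set w | W (word w s)]); first exact: subspace_preword.
move=> v x Vv Px; apply: (VW v (x :: s)); rewrite //= ?sk // => y.
by rewrite inE => /predU1P[->|/Ps].
Qed.

End Bracket.

(** * Families of homogeneous components, derived and generated subalgebras *)

Section Families.
Local Open Scope ring_scope.
Import GRing.Theory.
Context {K : fieldType} {L : lieAlgType K} {G : groupType}.
Implicit Types (A B R : G -> set L) (Y : pred G).

Definition graded_subalgebra A : Prop :=
  [/\ forall g, subspace (A g),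
      forall a b x y, A a x -> A b y -> A (a * b)%g (bracket x y) &
      forall a b x, A a x -> A b x -> a <> b -> x = 0].

Definition homog A : set L := [set x | exists g, A g x].

Definition famle A B : Prop := forall g, A g `<=` B g.

Definition der A (g : G) : set L :=
  span [set z | exists a b x y,
    [/\ A a x, A b y, g = (a * b)%g & z = bracket x y]].

Lemma mem_der A a b x y : A a x -> A b y -> der A (a * b)%g (bracket x y).
Proof. by move=> Aax Aby; apply: sub_span; exists a, b, x, y. Qed.

Lemma der_min A V g : subspace V ->
  (forall a b x y, A a x -> A b y -> g = (a * b)%g -> V (bracket x y)) ->
  der A g `<=` V.
Proof.
by move=> sV AV; apply: span_min => // z [a [b [x [y [Aax Aby gab ->]]]]];
  apply: AV Aby gab.
Qed.

Lemma der_le A B : famle A B -> famle (der A) (der B).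
Proof.
move=> AB g; apply: der_min; first exact: subspace_span.
by move=> a b x y /AB Ax /AB Ay ->; apply: mem_der.
Qed.

Lemma iter_der_le A B s : famle A B -> famle (iter s der A) (iter s der B).
Proof. by move=> AB; elim: s => //= s IH; apply: der_le. Qed.

Lemma der_sub A : graded_subalgebra A -> famle (der A) A.
Proof.
move=> [sA brA _] g; apply: der_min => // a b x y Aax Aby ->; exact: brA.
Qed.

Lemma der_graded A : graded_subalgebra A -> graded_subalgebra (der A).
Proof.
move=> gA; have dA := der_sub gA; split=> [g|a b x y /dA Ax /dA Ay|a b x].
- exact: subspace_span.
- exact: mem_der.
by case: gA => _ _ iA /dA Ax /dA Ay; apply: iA Ay.
Qed.

Lemma iter_der_decr A s t : graded_subalgebra A -> (s <= t)%N ->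
  famle (iter t der A) (iter s der A).
Proof.
move=> gA /subnK <-; rewrite iterD.
have gAs : graded_subalgebra (iter s der A).
  by elim: s => //= s IH; apply: der_graded.
elim: (t - s)%N => [|k IH] g //= x /(der_le IH).
exact: der_sub.
Qed.

(** Only right multiplication by a letter is built in, so that elements are sums of left-normed
    words and have last letters to argue on. Closure under the bracket is then a matter of the
    Jacobi identity, see [bracket_gen2]. *)
Inductive gen A Y : G -> L -> Prop :=
| gen_zero g : gen A Y g 0
| gen_lin g a x y : gen A Y g x -> gen A Y g y -> gen A Y g (a *: x + y)
| gen_letter g x : Y g -> A g x -> gen A Y g x
| gen_bracket g h u x : gen A Y g u -> Y h -> A h x ->
    gen A Y (g * h)%g (bracket u x).

Lemma subspace_gen A Y g : subspace (gen A Y g).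
Proof.
by apply/subspaceP; split=> [|a x y]; [apply: gen_zero|apply: gen_lin].
Qed.

Lemma gen_sub A Y : graded_subalgebra A -> famle (gen A Y) A.
Proof.
move=> [sA brA _] g x; elim=> {g x} // [g|g a x y _ Ax _ Ay|g h u x _ Au _].
- exact: subspace0.
- by have /subspaceP[_] := sA g; apply.
- exact: brA.
Qed.

Definition gen2 A Y (g : G) : set L :=
  span [set z | exists h y u x,
    [/\ gen A Y h u, Y y, A y x, g = (h * y)%g & z = bracket u x]].

Lemma gen2_sub A Y : famle (gen2 A Y) (gen A Y).
Proof.
move=> g; apply: span_min; first exact: subspace_gen.
by move=> z [h [y [u [x [hu Yy Ayx -> ->]]]]]; apply: gen_bracket.
Qed.

(** By antisymmetry the bracket has both weights [a * b] and [b * a], and distinct components meet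
    in 0. *)
Lemma bracket_noncommuting A a b x y : graded_subalgebra A ->
  A a x -> A b y -> ~ commute a b -> bracket x y = 0.
Proof.
move=> [sA brA iA] Ax Ay; apply: iA (brA _ _ _ _ Ax Ay) _.
by rewrite bracketC; apply: subspaceN => //; apply: brA.
Qed.

(** Induction on [v]: the Jacobi identity brings the last letter of [v] to the outside or next to
    [u]. The second term has its weights in another order, which is harmless: if they do not
    commute, the bracket vanishes anyway. *)
Lemma bracket_gen2 A Y g h u v : graded_subalgebra A ->
  gen A Y g u -> gen A Y h v -> gen2 A Y (g * h)%g (bracket u v).
Proof.
move=> gA gu hv; have s2 k : subspace (gen2 A Y k) by apply: subspace_span.
elim: hv g u gu => {h v} [h|h a x y _ IHx _ IHy|h x Yh Ahx|
    h k v x hv IH Yk Akx] g u gu.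
- by rewrite bracket0r; exact: subspace0.
- rewrite bracketPr; have /subspaceP[_] := s2 (g * h)%g.
  by apply; [apply: IHx|apply: IHy].
- by apply: sub_span; exists g, h, u, x.
have [hk|nhk] := pselect (commute h k); last first.
  rewrite (bracket_noncommuting gA (gen_sub gA hv) Akx nhk) //.
  by rewrite bracket0r; exact: subspace0.
rewrite bracketA; apply: (subspaceB (s2 _)).
  apply: sub_span; exists (g * h)%g, k, (bracket u v), x.
  by split=> //; [apply: gen2_sub; apply: IH|rewrite mulgA].
by rewrite hk mulgA; apply: IH; apply: gen_bracket.
Qed.

Lemma gen_graded A Y : graded_subalgebra A -> graded_subalgebra (gen A Y).
Proof.
move=> gA; split=> [g|a b x y gx gy|a b x /(gen_sub gA) Ax /(gen_sub gA) Ay].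
- exact: subspace_gen.
- exact: gen2_sub (bracket_gen2 gA gx gy).
- by case: gA => _ _ iA; apply: iA Ay.
Qed.

Lemma der_gen A Y : graded_subalgebra A -> famle (der (gen A Y)) (gen2 A Y).
Proof.
move=> gA g; apply: der_min; first exact: subspace_span.
by move=> a b x y gx gy ->; apply: bracket_gen2.
Qed.

End Families.

(** * Solvable graded subalgebras act nilpotently *)

Section Action.
Local Open Scope ring_scope.
Import GRing.Theory.
Context {K : fieldType} {L : lieAlgType K} {G : groupType}.
Variables (L_ : G -> set L) (X : seq G).
Hypothesis L_graded : graded_subalgebra L_.
Hypothesis L_supp : forall g x, L_ g x -> g \notin X -> x = 0.
Hypothesis X_gt0 : (0 < size X)%N.
(** The form in which arithmetic freeness enters the argument; it is established in [word_nil]. *)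
Hypothesis L_nil : forall g w s, size s = size X ->
  {in s, forall y, L_ g y} -> word w s = 0.
Implicit Types (A B R : G -> set L) (W : set L).

Let n := size X.

Lemma sub_homog A B : famle A B -> homog A `<=` homog B.
Proof. by move=> AB x [g /AB Bx]; exists g. Qed.

(** R' is an ideal of R: moving [x] past a letter [y] of R' creates the letter [y, x], again in
    R'. *)
Lemma chain_der_invariant R k w x : graded_subalgebra R ->
  chain (homog (der R)) k setT w -> homog R x ->
  chain (homog (der R)) k setT (bracket w x).
Proof.
move=> gR + [b Rx]; elim: k w => //= k IH w.
have sW : subspace (brset (chain (homog (der R)) k setT) (homog (der R))).
  exact: subspace_brset.
apply: (@brset_min _ _ _ _ [set w | brset _ _ (bracket w x)]).
  exact: subspace_prebracketl.
move=> {}w y /[dup] Ww /IH Wwx [a Ry] /=; rewrite bracketAC.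
apply: (subspaceD sW); first by apply: mem_brset => //; exists a.
by apply: mem_brset => //; exists (a * b)%g; apply: mem_der => //;
  apply: der_sub Ry.
Qed.

Lemma count_pigeonhole (T : Type) (wt : T -> G) (Z : seq G) m (s : seq T) :
  all (fun x => wt x \in Z) s -> (size Z * m < size s)%N ->
  exists2 h, h \in Z & (m < count (fun x => wt x == h) s)%N.
Proof.
elim: Z s => [|h Z IH] s; first by case: s.
move=> sZ; rewrite mulSn => lt_s.
have [|le_m] := ltnP m (count (fun x => wt x == h) s).
  by exists h; rewrite ?mem_head.
pose s' := [seq x <- s | wt x != h].
have [||k Zk lt_k] := IH s'.
- rewrite all_filter; apply: sub_all sZ => x /=.
  by rewrite inE; case: eqP.
- have := count_predC (fun x => wt x == h) s; rewrite size_filter.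
  move: lt_s le_m; set c := count _ s; set c' := count _ s => lt_s le_m E.
  rewrite -(ltn_add2l m); apply: leq_trans lt_s _.
  by rewrite -E leq_add2r.
exists k; first by rewrite inE Zk orbT.
apply: leq_trans lt_k _; rewrite count_filter.
by apply: sub_count => x /= /andP[].
Qed.

(* The hypotheses say that [P] acts on [V / W] by commuting operators. *)
Lemma word_filter (P V W : set L) (p : pred L) w s :
  subspace W ->
  (forall v x, V v -> P x -> V (bracket v x)) ->
  (forall v x, W v -> P x -> W (bracket v x)) ->
  (forall v x y, V v -> P x -> P y -> W (bracket v (bracket x y))) ->
  V w -> {in s, forall y, P y} ->
  W (word w s - word w ([seq y <- s | p y] ++ [seq y <- s | ~~ p y])).
Proof.
move=> sW VP WP VPP.
have Wword t : {in t, forall y, P y} -> forall v, W v -> W (word v t).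
  elim: t => //= x t IH Pt v Wv; apply: IH => [y ty|].
    by apply: Pt; rewrite inE ty orbT.
  by apply: WP => //; apply: Pt; rewrite mem_head.
have move_letter x s1 s2 : {in x :: s1 ++ s2, forall y, P y} ->
    forall v, V v -> W (word v (x :: s1 ++ s2) - word v (s1 ++ x :: s2)).
  elim: s1 => [|y s1 IH] Ps v Vv /=.
    by rewrite subrr; exact: subspace0.
  have Px : P x by apply: Ps; rewrite mem_head.
  have Py : P y by apply: Ps; rewrite !inE eqxx orbT.
  have Ps' : {in x :: s1 ++ s2, forall z, P z}.
    move=> z; rewrite inE => /predU1P[->//|zs].
    by apply: Ps; rewrite !inE zs !orbT.
  rewrite -[X in X - _](subrK (word v (y :: x :: s1 ++ s2))) -addrA.
  apply: (subspaceD sW) => /=; last by apply: (IH Ps'); apply: VP.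
  (* Swapping the neighbours [x] and [y] changes the word by one starting with
     [bracket v (bracket x y)], which lies in [W]. *)
  rewrite -wordB bracketAC addrC addKr.
  apply: Wword; last exact: VPP.
  by move=> z zs; apply: Ps'; rewrite inE zs orbT.
elim: s w => [|x s IH] w Vw Ps /=; first by rewrite subrr; exact: subspace0.
have Px : P x by apply: Ps; rewrite mem_head.
have Ps' : {in s, forall y, P y} by move=> y ys; apply: Ps; rewrite inE ys orbT.
have := IH _ (VP _ _ Vw Px) Ps'; case: ifP => //= px.
set s1 := filter p s; set s2 := filter _ s => W1.
rewrite -[X in X - _](subrK (word w (x :: s1 ++ s2))) -addrA.
apply: (subspaceD sW) => //; apply: move_letter => // y.
rewrite inE mem_cat !mem_filter => /predU1P[->//|].
by rewrite -andb_orl => /andP[_ /Ps'].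
Qed.

(** Among [n ^ 2] letters with at most [n] weights, some weight occurs [n] times. Modulo [W] these
    letters can be gathered right after [w], where [L_nil] applies. *)
Lemma word_pigeonhole (P V W : set L) w s :
  subspace W -> P `<=` homog L_ ->
  (forall v x, V v -> P x -> V (bracket v x)) ->
  (forall v x, W v -> P x -> W (bracket v x)) ->
  (forall v x y, V v -> P x -> P y -> W (bracket v (bracket x y))) ->
  V w -> size s = (n ^ 2)%N -> {in s, forall y, P y} -> W (word w s).
Proof.
move=> sW PL VP WP VPP Vw ss Ps.
(* A weight is chosen for each letter; outside [P] the value 1 is a dummy. *)
have [x|wt wtP] := @choice L G (fun x g => P x -> L_ g x).
  have [Px|nPx] := pselect (P x); last by exists 1%g.
  by have [g Lx] := PL _ Px; exists g.
have [sX|] := boolP (all (fun x => wt x \in X) s); last first.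
  case/allPn=> x xs /(L_supp (wtP _ (Ps _ xs))) x0.
  suff -> : word w s = 0 by exact: subspace0.
  move: xs; rewrite x0 => /splitPr[s1 s2].
  by rewrite word_cat /= bracket0r word0.
(* More than [n.-1] occurrences means at least [n], and [n * n.-1 < n ^ 2]. *)
have [|h Xh hs] := @count_pigeonhole _ wt X n.-1 s sX.
  by rewrite ss expnS expn1 ltn_pmul2l // ltn_predL.
pose p x := wt x == h; rewrite -(subrK (word w ([seq y <- s | p y] ++
  [seq y <- s | ~~ p y])) (word w s)).
apply: (subspaceD sW); first exact: (@word_filter P V W).
rewrite word_cat -[filter p s](cat_take_drop n) word_cat.
rewrite (@L_nil h w) ?word0; first exact: subspace0.
  rewrite size_takel // size_filter; apply: leq_trans hs.
  by rewrite prednK.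
by move=> y /mem_take; rewrite mem_filter => /andP[/eqP <- /Ps /wtP].
Qed.

(** Induction on the derived length. The chain of R' has R-invariant terms, and R acts on its
    sections by commuting operators, so [n ^ 2] letters of R descend one term. *)
Lemma solvable_chain s R : graded_subalgebra R -> famle R L_ ->
  famle (iter s der R) (fun=> [set 0]) ->
  chain (homog R) (n ^ (2 * s)) setT `<=` [set 0].
Proof.
elim: s R => [|s IH] R gR RL R0.
  apply: brset_min; first exact: subspace_set0.
  by move=> w x _ [g /R0 ->] /=; rewrite bracket0r.
have gR' := der_graded gR.
have R'L : famle (der R) L_ by move=> g x /(der_sub gR) /RL.
have {}IH := IH (der R) gR' R'L; rewrite -iterSr in IH.
move=> w Ww; apply: (IH R0); move: w Ww => {IH}.
(* Generalised to any [k]: [k * n ^ 2] letters of R lead into the term of index [k] of the chain of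
   R'. *)
rewrite mulnS expnD mulnC; elim: (n ^ _)%N => [|k IHk] //.
rewrite mulSn /chain iterD => w /(chain_sub IHk); move: w.
apply: chain_words => [|w t Ww tn tR]; first exact: subspace_brset.
apply: word_pigeonhole Ww tn tR => //.
- exact: subspace_brset.
- exact: sub_homog.
- by move=> v x; apply: chain_der_invariant.
- by move=> v x; apply: (@chain_der_invariant R k.+1).
move=> v x y Vv [a Rx] [b Ry]; apply: mem_brset => //.
by exists (a * b)%g; apply: mem_der.
Qed.

(** * Elimination of weights *)

Hypothesis L_1 : L_ 1%g `<=` [set 0].
Implicit Types (D E : seq G) (d g h : G).

Definition off D : pred G := [pred g | g \notin D].

Lemma offE D g : off D g = (g \notin D).
Proof. by []. Qed.

Definition off_bracket A D g : set L :=
  span [set z | exists h y u x,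
    [/\ A h u, y \notin D, A y x, g = (h * y)%g & z = bracket u x]].

Lemma off_bracket_le A B D g :
  famle A B -> off_bracket A D g `<=` off_bracket B D g.
Proof.
move=> AB; apply: span_min => [|_ [h [y [u [x [Au yD Ax -> ->]]]]]].
  exact: subspace_span.
by apply: sub_span; exists h, y, u, x; split=> //; apply: AB.
Qed.

(* The last letter of a word of weight [d] and length at least 2 is not of
   weight [d], as there is nothing of weight 1. *)
Lemma der_gen_off A D d : uniq D -> graded_subalgebra A -> famle A L_ ->
  der (gen A (off (rem d D))) d `<=` off_bracket A D d.
Proof.
move=> uD gA AL x /(der_gen gA); move: x.
apply: span_min => [|_ [h [y [u [x [hu yD Ax dhy ->]]]]]].
  exact: subspace_span.
have Au := gen_sub gA hu.
have [yd|yd] := eqVneq y d.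
  have h1 : h = 1%g by apply: (mulIg d); rewrite mul1g [RHS]dhy yd.
  move: Au; rewrite h1 => /AL /L_1 ->.
  by rewrite bracket0l; apply: subspace0; apply: subspace_span.
apply: sub_span; exists h, y, u, x; split=> //.
by move: yD; rewrite offE mem_rem_uniq // inE yd.
Qed.

Definition elim_step D A d : G -> set L := der (gen A (off (rem d D))).

Definition elim_round D A E : G -> set L := foldl (elim_step D) A E.

Lemma elim_step_graded D A d :
  graded_subalgebra A -> graded_subalgebra (elim_step D A d).
Proof. by move=> gA; apply/der_graded/gen_graded. Qed.

Lemma elim_step_sub D A d : graded_subalgebra A -> famle (elim_step D A d) A.
Proof.
by move=> gA g x /der_sub-/(_ (gen_graded _ gA)); apply: gen_sub.
Qed.

Lemma elim_round_graded D A E :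
  graded_subalgebra A -> graded_subalgebra (elim_round D A E).
Proof. by elim: E A => //= d E IH A gA; apply/IH/elim_step_graded. Qed.

Lemma elim_round_sub D A E : graded_subalgebra A -> famle (elim_round D A E) A.
Proof.
elim: E A => [|d E IH] A gA g x //= Ex.
apply: (elim_step_sub (D := D) (d := d) gA).
by apply: IH Ex; apply: elim_step_graded.
Qed.

(** The step for [d] gives the inclusion: the steps before it start from a smaller family than [A],
    and those after it only shrink the result. *)
Lemma elim_round_off D A E d : uniq D -> graded_subalgebra A -> famle A L_ ->
  d \in E -> elim_round D A E d `<=` off_bracket A D d.
Proof.
move=> uD; elim: E A => //= e E IH A gA AL dE x.
have gA' := elim_step_graded D e gA; have A'A := @elim_step_sub D A e gA.
have [<-|ne] := eqVneq d e.
  by move=> /elim_round_sub-/(_ (elim_step_graded _ _ gA))/der_gen_off; apply.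
move: dE; rewrite inE (negbTE ne) => dE.
move=> /IH-/(_ gA' (fun g y Ay => AL g y (A'A g y Ay)) dE).
exact: off_bracket_le.
Qed.

Definition elim_rounds D A k : G -> set L :=
  iter k (fun B => elim_round D B D) A.

Lemma elim_rounds_graded D A k :
  graded_subalgebra A -> graded_subalgebra (elim_rounds D A k).
Proof. by move=> gA; elim: k => //= k; apply: elim_round_graded. Qed.

Lemma elim_rounds_sub D A k :
  graded_subalgebra A -> famle (elim_rounds D A k) A.
Proof.
move=> gA; elim: k => [|k IH] g x //= /elim_round_sub.
by move=> /(_ (elim_rounds_graded _ _ gA)); apply: IH.
Qed.

(* Removing last letters one at a time, a weight either leaves [D], and then the
   element is in the subalgebra generated off [D], or stays in [D] [k] times. *)
Lemma elim_rounds_split D A k g x :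
  uniq D -> graded_subalgebra A -> famle A L_ -> elim_rounds D A k g x ->
  exists r w, [/\ gen A (off D) g r, chain (homog (gen A (off D))) k setT w &
    x = r + w].
Proof.
move=> uD gA AL; set R := gen A _.
have sR h : subspace (R h) by apply: subspace_gen.
elim: k g x => [|k IH] g x.
  by move=> _; exists 0, x; split=> //; [apply: subspace0|rewrite add0r].
have gAk := elim_rounds_graded D k gA; have AkA := @elim_rounds_sub D A k gA.
have AkL : famle (elim_rounds D A k) L_ by move=> h y /AkA /AL.
have sC : subspace (chain (homog R) k.+1 setT) by apply: subspace_brset.
move=> Akx; have [gD|gD] := boolP (g \in D); last first.
  exists x, 0; split; [|exact: subspace0|by rewrite addr0].
  by apply: gen_letter => //; apply: AkA; apply: elim_round_sub Akx.
have {Akx} := elim_round_off uD gAk AkL gD Akx; move: x.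
apply: span_min => [|_ [h [y [u [x [/IH[r [w [Rr Cw ->]]] yD /AkA Ax -> ->]]]]]].
  apply/subspaceP; split=> [|a _ _ [r1 [w1 [R1 C1 ->]]] [r2 [w2 [R2 C2 ->]]]].
    by exists 0, 0; split; [exact: subspace0|exact: subspace0|rewrite addr0].
  exists (a *: r1 + r2), (a *: w1 + w2); split.
  - by have /subspaceP[_] := sR g; apply.
  - by have /subspaceP[_] := sC; apply.
  - by rewrite scalerDr addrACA.
exists (bracket r x), (bracket w x); rewrite bracketDl; split=> //.
  exact: gen_bracket.
by apply: mem_brset => //; exists y; apply: gen_letter.
Qed.

Definition solvable_le s A : Prop := famle (iter s der A) (fun=> [set 0]).

Lemma solvable_le_sub s A B : famle A B -> solvable_le s B -> solvable_le s A.
Proof. by move=> AB B0 g x /(iter_der_le AB) /B0. Qed.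

Section Backward.
Variables (D : seq G) (phi : nat -> nat).
Hypothesis phiP : forall d A t, d \in D -> graded_subalgebra A -> famle A L_ ->
  solvable_le t (gen A (off (rem d D))) -> solvable_le (phi t) A.

(** The shift accounts for the derived algebra taken in [elim_step]: undoing one step costs one more
    derivation before [phi] applies. *)
Let psi t := phi t.+1.

Lemma elim_round_solvable A E t : {subset E <= D} ->
  graded_subalgebra A -> famle A L_ ->
  solvable_le t (elim_round D A E) -> solvable_le (iter (size E) psi t) A.
Proof.
elim: E A => //= d E IH A ED gA AL.
have gA' := elim_step_graded D d gA; have A'A := @elim_step_sub D A d gA.
move=> /IH sA; apply: (@phiP d) => //; first by apply: ED; rewrite mem_head.
rewrite /solvable_le iterSr; apply: sA => //.
- by move=> e eE; apply: ED; rewrite inE eE orbT.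
- by move=> g x /A'A /AL.
Qed.

Lemma elim_rounds_solvable A k t : graded_subalgebra A -> famle A L_ ->
  solvable_le t (elim_rounds D A k) -> solvable_le (iter (k * size D) psi t) A.
Proof.
move=> gA AL; elim: k t => //= k IH t /elim_round_solvable sA.
rewrite mulSn addnC iterD; apply: IH; apply: sA => //.
  exact: elim_rounds_graded.
by move=> g x /(elim_rounds_sub gA) /AL.
Qed.

(** After [n ^ (2 * s)] rounds the chain part in [elim_rounds_split] vanishes by [solvable_chain],
    so what is left lies in [gen A (off D)]. The bound is then carried back through all the
    steps. *)
Lemma elimination A s : uniq D -> graded_subalgebra A -> famle A L_ ->
  solvable_le s (gen A (off D)) ->
  solvable_le (iter (n ^ (2 * s) * size D) psi s) A.
Proof.
move=> uD gA AL sR; apply: elim_rounds_solvable => //.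
apply: solvable_le_sub (sR) => g x /elim_rounds_split[//|//|//|r [w [Rr + ->]]].
have RL : famle (gen A (off D)) L_ by move=> h y /(gen_sub gA) /AL.
by move=> /(solvable_chain (gen_graded _ gA) RL sR) ->; rewrite addr0.
Qed.

End Backward.

(* A bound for the derived length when [b] weights remain to be eliminated, given
   the derived length [s] of the subalgebra generated by the other components:
   each of [m ^ (2 * s)] rounds handles each of the [b] weights once. *)
Fixpoint elim_length (m b s : nat) : nat :=
  match b with
  | 0 => s
  | 1 => s.+1
  | b'.+1 => iter (m ^ (2 * s) * b) (fun t => elim_length m b' t.+1) s
  end.

(** Induction on the size of [D]. For a single weight [d] one derivation suffices: in a bracket of
    weight [d], a factor of weight [d] would force the other to have weight 1, hence to be 0. *)
Lemma elim_length_solvable D A s : uniq D -> graded_subalgebra A ->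
  famle A L_ -> solvable_le s (gen A (off D)) ->
  solvable_le (elim_length n (size D) s) A.
Proof.
have [b] := ubnPeq (size D); elim: b D A s => [|b IH] D A s.
  case: D => //= _ _ gA AL; apply: solvable_le_sub => g x Ax.
  exact: gen_letter.
case: b IH => [|b] IH sD uD gA AL sR.
  move: sD uD sR; case: D => [|d []] //= _ uD sR.
  rewrite /solvable_le iterSr; apply: solvable_le_sub sR => g x dx.
  have [gd|gd] := eqVneq g d; last first.
    by apply: gen_letter; [rewrite offE inE|apply: der_sub dx].
  (* As [rem d [:: d]] is empty, all of [A] serves as letters and [der_gen_off] becomes
     applicable. *)
  have {dx} : der (gen A (off (rem d [:: d]))) d x.
    rewrite -gd; apply: der_le dx => h y Ay; apply: gen_letter => //.
    by rewrite offE /= eqxx.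
  move=> /der_gen_off-/(_ uD gA AL); rewrite gd; move: x.
  apply: span_min => [|_ [h [y [u [x [Au yD Ax dhy ->]]]]]].
    exact: subspace_gen.
  have [hd|hd] := eqVneq h d; last first.
    rewrite [X in gen _ _ X]dhy; apply: gen_bracket => //.
    apply: gen_letter => //.
    by rewrite offE inE.
  have y1 : y = 1%g by apply: (mulgI d); rewrite mulg1 [RHS]dhy hd.
  move: Ax; rewrite y1 => /AL /L_1 ->.
  by rewrite bracket0r; apply: gen_zero.
have := @elimination D (elim_length n b.+1) _ A s uD gA AL sR.
rewrite (eqP sD); apply => d B t dD gB BL; apply: IH => //.
  by rewrite size_rem // (eqP sD).
exact: rem_uniq.
Qed.

(** * Start from a single weight, and the bound for the whole algebra *)

Lemma chain_gen_bracket A (P : set L) (Y : pred G) k g u v :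
  (forall h x, Y h -> A h x -> P x) -> chain P k setT u -> gen A Y g v ->
  chain P k.+1 setT (bracket u v).
Proof.
move=> YP + gv; have sC m : subspace (chain P m.+1 setT).
  exact: subspace_brset.
elim: gv u => {g v} [g|g a x y _ IHx _ IHy|g x Yg Ax|
    g h v x _ IH Yh Ax] u Cu.
- by rewrite bracket0r; apply: subspace0 (sC k).
- rewrite bracketPr; have /subspaceP[_] := sC k.
  by apply; [apply: IHx|apply: IHy].
- by apply: mem_brset => //; apply: YP Ax.
have Px : P x by apply: YP Ax.
(* Both Jacobi terms gain two factors from [P] and from [v]; one gain is enough, as the chain
   decreases. *)
rewrite bracketA; apply: (subspaceB (sC k)).
  by apply: (chain_le (leqnSn _)); apply: mem_brset => //; apply: IH.
by apply: IH; apply: (chain_le (leqnSn _)); apply: mem_brset.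
Qed.

(** The derived series lies in the lower central series: of the two factors of a bracket, one keeps
    its depth and the other is only used as an element of [gen A Y]. *)
Lemma iter_der_gen_chain A (P : set L) (Y : pred G) k g :
  graded_subalgebra A -> (forall h x, Y h -> A h x -> P x) ->
  iter k der (gen A Y) g `<=` chain P k setT.
Proof.
move=> gA YP; elim: k g => //= k IH g.
apply: der_min => [|a b x y /IH Cx gy _]; first exact: subspace_brset.
apply: (chain_gen_bracket YP Cx (g := b)).
exact: (iter_der_decr (gen_graded Y gA) (leq0n k)) gy.
Qed.

(** The elimination removes the [n.-1] weights other than [y]. The subalgebra generated at [y] has
    derived length at most [n] by [L_nil], and [solvable_chain] turns the resulting derived length
    of the whole algebra into nilpotency. *)
Lemma homog_chain : uniq X ->
  chain (homog L_) (n ^ (2 * elim_length n n.-1 n)) setT `<=` [set 0].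
Proof.
move=> uX; have [y yX] : exists y, y \in X.
  by move: X_gt0; case: (X) => // y s _; exists y; rewrite mem_head.
apply: (solvable_chain L_graded) => [g x //|].
have <- : size (rem y X) = n.-1 by rewrite size_rem.
apply: elim_length_solvable => //; [exact: rem_uniq|by move=> g x|].
have [sL _ _] := L_graded.
have nil_y : chain (L_ y) n setT `<=` [set 0].
  apply: chain_words => [|w s _ sn sy]; first exact: subspace_set0.
  exact: L_nil sn sy.
move=> g x dx; apply/nil_y/(iter_der_gen_chain L_graded _ dx) => h z + Lz.
(* A letter of weight off [rem y X] has weight [y], or a weight outside [X] and is then 0. *)
rewrite offE mem_rem_uniq // inE negb_and negbK.
case/orP => [/eqP<- //|hX]; rewrite (L_supp Lz hX).
exact: subspace0.
Qed.

End Action.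

(** * Comparison of the elimination bound with the Higman map *)

Section HigmanBound.
Local Open Scope nat_scope.
Variable m : nat.
Hypothesis m_gt2 : 2 < m.

Lemma higman3_Sr b c : 0 < c -> higman3 m b c <= higman3 m b c.+1.
Proof.
case: b => [|[|b]] // c_gt0.
by rewrite (@higman3_rec m b.+2 c.+1) // !subn1 /= leq_maxr.
Qed.

Lemma higman3_homo b c d : 0 < c -> c <= d -> higman3 m b c <= higman3 m b d.
Proof.
move=> c_gt0 /subnKC <-; elim: (d - c) => [|k IH]; first by rewrite addn0.
by rewrite addnS; apply: leq_trans IH (higman3_Sr _ _); rewrite ltn_addr.
Qed.

Lemma higman3_ge b c : 0 < c ->
  m * higman_f c.+1
    (m + higman3 m b.+1 (m * higman_f c (higman3 m b.+2 c)) + 1)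
  <= higman3 m b.+2 c.+1.
Proof.
move=> c_gt0; rewrite (@higman3_rec m b.+2 c.+1) // !subn1 /=.
by rewrite leq_max leq_maxl.
Qed.

Lemma higman_f_ge_l alpha lambda : 0 < lambda -> 0 < alpha ->
  alpha <= higman_f alpha lambda.
Proof.
move=> l0 a0; rewrite /higman_f; case: lambda l0 => // l _.
by rewrite expnS mulnCA leq_pmulr // muln_gt0 expn_gt0 a0.
Qed.

Lemma higman_f_ge_r alpha lambda : 0 < alpha -> lambda <= higman_f alpha lambda.
Proof. by move=> a0; rewrite leq_pmulr // expn_gt0 a0. Qed.

Lemma higman3_ge_id b c : 0 < c -> c <= higman3 m b.+2 c.
Proof.
case: c => // -[|c] _; first by rewrite higman3_1r // (ltn_trans _ m_gt2).
apply: leq_trans (higman3_ge b (ltn0Sn c)).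
apply: leq_trans (higman_f_ge_l _ (ltn0Sn _)) (leq_pmull _ _).
  by rewrite addn1.
by rewrite (ltn_trans _ m_gt2).
Qed.

(** Only the nested value is kept: it matches one iteration in [elim_length]. *)
Lemma higman3_Sr_ge b c : 0 < c ->
  higman3 m b.+1 (m * higman_f c (higman3 m b.+2 c)) <= higman3 m b.+2 c.+1.
Proof.
move=> c0; apply: leq_trans (higman3_ge b c0).
have m0 : 0 < m by rewrite (ltn_trans _ m_gt2).
set h := higman3 _ _ _.
apply: leq_trans (leq_pmull _ m0); apply: leq_trans (higman_f_ge_r _ _) => //.
by rewrite addnAC leq_addl.
Qed.

Lemma elim_length2 s : elim_length m 2 s = s + 2 * (2 * m ^ (2 * s)).
Proof.
rewrite /= [in LHS]mulnC; elim: (2 * _) => [|k IH] /=; first by rewrite addn0.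
by rewrite IH; lia.
Qed.

(** Each iteration in [elim_length] is paid for by raising the last argument of [higman3] by one.
    The factor 2 lets the induction feed the exponents [2 * s] directly. *)
Lemma double_elim_length b s : b.+2 <= m ->
  2 * elim_length m b.+2 s <= higman3 m b.+2 (m ^ (2 * s + 4)).
Proof.
have m0 : 0 < m by rewrite (ltn_trans _ m_gt2).
have s_le k : k <= m ^ k by apply/ltnW/ltn_expl/ltnW.
elim: b s => [|b IH] s b_le.
  apply: leq_trans (higman3_ge_id _ _); last by rewrite expn_gt0 m0.
  rewrite elim_length2 expnD.
  apply: (@leq_trans (m ^ (2 * s) * 3 ^ 4)).
    by rewrite (_ : 3 ^ 4 = 81) //; have := s_le (2 * s); lia.
  by rewrite leq_mul2l leq_exp2r // m_gt2 orbT.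
(* The offset [2 * s] settles [i = 0], and [m ^ 3] makes the base [c] large enough for the power
   below. *)
have step i : 2 * iter i (fun t => elim_length m b.+2 t.+1) s
    <= higman3 m b.+3 (m ^ 3 + 2 * s + i).
  elim: i => [|i IHi].
    apply: leq_trans (higman3_ge_id _ _); first by rewrite addn0 leq_addl.
    by rewrite addn0 addn_gt0 expn_gt0 m0.
  set c := m ^ 3 + 2 * s + i in IHi *.
  have c_ge : m ^ 3 <= c by rewrite /c -addnA leq_addr.
  have c0 : 0 < c by apply: leq_trans c_ge; rewrite expn_gt0 m0.
  rewrite addnS iterS; set t := iter i _ s in IHi *.
  apply: leq_trans (IH t.+1 (ltnW b_le)) _; apply: leq_trans (higman3_Sr_ge _ c0).
  apply: higman3_homo; first by rewrite expn_gt0 m0.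
  have x_ge := higman3_ge_id b.+1 c0.
  move: IHi x_ge; set x := higman3 _ _ c => tx cx.
  have x6 : 6 <= x.
    apply: leq_trans cx; apply: leq_trans c_ge.
    by apply: (@leq_trans (3 ^ 3)); rewrite ?leq_exp2r.
  (* From [c >= m ^ 3] the power is at least [m ^ (3 * x)], and [2 * t.+1 + 4 <= 3 * x] because
     [2 * t <= x] and [6 <= x]. *)
  rewrite /higman_f mulnA; apply: leq_trans (leq_pmull _ _).
    apply: (@leq_trans ((m ^ 3) ^ x)); last by rewrite leq_exp2r ?(leq_trans _ x6).
    by rewrite -expnM leq_exp2l ?(ltn_trans _ m_gt2) //; lia.
  by rewrite muln_gt0 m0 (leq_trans _ x6).
apply: leq_trans (step _) _; apply: higman3_homo.
  by rewrite -addnA ltn_addr // expn_gt0 m0.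
have M0 : 0 < m ^ (2 * s) by rewrite expn_gt0 m0.
have sM := s_le (2 * s); have m3 : m <= m ^ 3.
  by rewrite -[X in X <= _]expn1 leq_exp2l // (ltn_trans _ m_gt2).
rewrite expnD (expnS m 3) mulnCA; set q := m ^ 3 in m3 *.
set M := m ^ (2 * s) in M0 sM *; have q0 : 0 < q by apply: leq_trans m3.
have le1 : q <= M * q by rewrite leq_pmull.
have le2 : M <= M * q by rewrite leq_pmulr.
have le3 : M * b.+3 <= M * q by rewrite leq_mul2l (leq_trans b_le m3) orbT.
apply: (@leq_trans (3 * (M * q))); last by rewrite leq_mul2r m_gt2 orbT.
by move: (M * q) (M * b.+3) le1 le2 le3 sM; lia.
Qed.

(** The outermost [higman_f] supplies the power of [m], and the nested [higman3] in its exponent is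
    compared by [double_elim_length]. *)
Lemma higman_bound : m ^ (2 * elim_length m m.-1 m) <= higman m.
Proof.
have [b mb] : exists b, m = b.+3.
  by case: (m) m_gt2 => [|[|[|b]]] // _; exists b.
have m0 : 0 < m by rewrite mb.
have := higman3_ge b.+1 (c := b.+2) isT; rewrite -mb -/(higman m).
apply: leq_trans; apply: leq_trans (leq_pmull _ m0).
apply: leq_trans (leq_pmull _ _); last by rewrite addn1.
rewrite leq_exp2l ?(ltn_trans _ m_gt2) // -addnA addnCA.
apply: (@leq_trans (higman3 m b.+2 (m ^ (2 * m + 4)))).
  by rewrite (_ : m.-1 = b.+2) ?double_elim_length ?mb.
apply: leq_trans (leq_addr _ _); apply: higman3_homo.
  by rewrite expn_gt0 m0.
(* The available base is [m.-1], possibly 2, so the exponent must compensate: [x >= m * (2 * m + 4)]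
   yields [2 ^ x >= m ^ (2 * m + 4)]. *)
have := higman3_ge b.+1 (c := b.+1) isT; rewrite -mb.
set lam := _ + 1; set x := higman3 m m _ => lam_x.
have lam_ge : m < lam by rewrite /lam -addnA addn1 addnS ltnS leq_addr.
have lam_pow : 4 <= b.+2 ^ lam.
  apply: (@leq_trans (2 ^ lam)).
    by rewrite -[4]/(2 ^ 2) leq_exp2l // (ltn_trans _ lam_ge) // ltnW.
  by rewrite leq_exp2r // (leq_trans _ lam_ge).
have x_ge : m * (2 * m + 4) <= x.
  apply: leq_trans lam_x; rewrite leq_mul2l; apply/orP; right.
  apply: (@leq_trans (lam * 4)); last by rewrite leq_mul2l lam_pow orbT.
  by move: lam_ge; lia.
apply: leq_trans (leq_pmull _ m0).
apply: leq_trans (leq_pmull _ _); last first.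
  by apply: leq_trans x_ge; rewrite muln_gt0 m0 addn_gt0 orbT.
apply: (@leq_trans (2 ^ x)).
  apply: (@leq_trans ((2 ^ m) ^ (2 * m + 4))).
    by rewrite leq_exp2r ?addn_gt0 ?orbT // ltnW // ltn_expl.
  by rewrite -expnM leq_exp2l.
by rewrite leq_exp2r // (leq_trans _ x_ge) // muln_gt0 m0 addn_gt0 orbT.
Qed.

End HigmanBound.

(** The values 1 and 2 are settled by computation: 1 against 1, and 64 against 128. *)
Lemma higman_bound_gt0 n :
  (0 < n)%N -> (n ^ (2 * elim_length n n.-1 n) <= higman n)%N.
Proof. by case: n => [|[|[|n]]] // _; apply: higman_bound. Qed.

(** * From arithmetically-free gradings to the nilpotency class *)

Section Grading.
Local Open Scope ring_scope.
Import GRing.Theory.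
Context {K : fieldType} {L : lieAlgType K} {G : groupType} {L_ : G -> set L}.
Hypothesis L_grading : is_grading L_.

Lemma grading_sum_homog V : subspace V -> homog L_ `<=` V -> V = setT.
Proof.
have [_ Ldec _] := L_grading => sV LV; apply/seteqP; split=> // x _.
have [f [[Lf ->] _]] := Ldec x.
by elim/big_rec: _ => [|g y _ Vy]; [apply: subspace0|apply: subspaceD => //;
  apply: LV; exists g].
Qed.

(** Placing [x] at [a] or at [b] gives two decompositions of [x], which must coincide. *)
Lemma grading_independent a b x : L_ a x -> L_ b x -> a <> b -> x = 0.
Proof.
have [sL Ldec _] := L_grading => Lax Lbx /eqP ab.
have [f [_ uf]] := Ldec x.
pose single c := [fsfun g in [fset c]%fset => x | 0]%fset : {fsfun G -> L with 0}.
have singleE c g : single c g = if g == c then x else 0.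
  by rewrite fsfunE inE.
have single_dec c : L_ c x ->
    (forall g, L_ g (single c g)) /\ x = \sum_(g <- finsupp (single c)) single c g.
  move=> Lcx; split=> [g|].
    by rewrite singleE; case: eqP => [->|_] //; apply: subspace0.
  (* The support is empty when [x = 0], so the sum is first extended to the singleton of [c]. *)
  rewrite (@big_fset_incl _ _ _ _ _ [fset c]%fset).
  - by rewrite big_seq_fset1 singleE eqxx.
  - exact: finsupp_sub.
  - by move=> g _ gs; apply: fsfun_dflt.
have E : single a = single b.
  by rewrite -(uf _ (single_dec a Lax)) -(uf _ (single_dec b Lbx)).
by have := singleE a a; rewrite E singleE eqxx (negbTE ab).
Qed.

Lemma grading_graded_subalgebra : graded_subalgebra L_.
Proof.
have [sL _ brL] := L_grading; split=> // a b x Lax Lbx.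
exact: grading_independent.
Qed.

(** Homogeneous elements span, so letters may be taken homogeneous. *)
Lemma lower_central_chain k : lower_central L k `<=` chain (homog L_) k setT.
Proof.
elim: k => //= k IH; apply: smallest_sub; first exact: subspace_brset.
move=> _ [x /IH Cx [y _ <-]].
have sB : subspace [set y | brset (chain (homog L_) k setT) (homog L_) (bracket x y)].
  by apply: subspace_prebracketr; apply: subspace_brset.
suff /seteqP[_ /(_ y I)] : [set y | brset (chain (homog L_) k setT) (homog L_)
    (bracket x y)] = setT by [].
by apply: grading_sum_homog => // z Lz; apply: mem_brset.
Qed.

Hypothesis L_free : arithmetically_free (grading_support L_).
Let X := grading_support L_.
Let S : seq G := enum_fset (fset_set X).

Lemma mem_support g : (g \in S) = (g \in X).
Proof. by case: L_free => fX _; rewrite -[RHS](in_fset_set fX). Qed.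

Lemma supportP g x : L_ g x -> x <> 0 -> X g.
Proof. by move=> Lx x0 L0; apply: x0; rewrite L0 in Lx. Qed.

Lemma not_support g x : L_ g x -> g \notin S -> x = 0.
Proof.
rewrite mem_support => Lx; have [//|x0] := pselect (x = 0).
by rewrite (mem_set (supportP Lx x0)).
Qed.

Lemma progression_not_sub Z x g : Z `<=` X -> Z x -> Z g ->
  (forall a b, Z a -> Z b -> commute a b) -> ~ (progression x g `<=` Z).
Proof. by case: L_free => _ + ZX Zx Zg cZ => /(_ Z ZX cZ)[_]; apply. Qed.

Lemma L_1_eq0 : L_ 1%g `<=` [set 0].
Proof.
move=> x Lx; have [//|x0] := pselect (x = 0).
have X1 := supportP Lx x0.
case: (@progression_not_sub [set 1%g] 1%g 1%g) => //= [_ ->//|_ _ -> ->//|].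
by move=> _ [k _ <-] /=; rewrite mul1g expg1n.
Qed.

(** Every prefix of a nonzero word is nonzero, so its weight lies in the support. *)
Lemma word_support h w g s : L_ g w -> word w s <> 0 ->
  {in s, forall y, L_ h y} -> forall k, (k <= size s)%N -> X (g * h ^+ k)%g.
Proof.
have [sL _ brL] := L_grading.
elim: s g w => [|y s IH] g w Lw ws0 Ls k.
  by rewrite leqn0 => /eqP ->; rewrite expg0 mulg1; apply: supportP ws0.
case: k => [_|k] /=.
  rewrite expg0 mulg1; apply: (supportP Lw) => w0.
  by apply: ws0; rewrite w0 word0.
rewrite ltnS expgS mulgA; apply: (IH _ (bracket w y)) => //.
  by apply: brL => //; apply: Ls; rewrite mem_head.
by move=> z zs; apply: Ls; rewrite inE zs orbT.
Qed.

(* By the pigeonhole principle a nonzero word makes [g, g h, g h^2, ...]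
   return to itself inside the support. *)
Lemma word_nil_homog g h w s : L_ g w -> (0 < size S)%N -> size s = size S ->
  {in s, forall y, L_ h y} -> word w s = 0.
Proof.
have [sL _ brL] := L_grading.
move=> Lw S0 sS Ls; have [//|ws0] := pselect (word w s = 0).
have Xgh := word_support Lw ws0 Ls; rewrite sS in Xgh.
have [y ys] : exists y, y \in s.
  by case: (s) sS => [|y t _]; [case: (S) S0|exists y; rewrite mem_head].
have Xh : X h.
  apply: (supportP (Ls _ ys)) => y0; apply: ws0; move: ys; rewrite y0.
  by case/splitPr=> s1 s2; rewrite word_cat /= bracket0r word0.
have cgh : commute g h.
  have [//|ncgh] := pselect (commute g h).
  case: s sS Ls ws0 {ys} => [|z s] /=; first by case: (S) S0.
  move=> _ Ls []; rewrite (bracket_noncommuting grading_graded_subalgebra Lw _ ncgh).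
    exact: word0.
  by apply: Ls; rewrite mem_head.
pose p (i : 'I_(size S).+1) := (g * h ^+ i)%g.
have [i [j [ij eij]]] : exists i j : 'I_(size S).+1, (i < j)%N /\ p i = p j.
  have /injectivePn[i [j nij eij]] : ~~ injectiveb p.
    apply/negP => /uniq_leq_size-/(_ S); rewrite size_map -cardE card_ord ltnn.
    move=> le; suff: false by []; apply: le => _ /mapP[i _ ->].
    by rewrite mem_support; apply/mem_set/Xgh; rewrite -ltnS.
  have [ltij|] := ltnP i j; first by exists i, j.
  by rewrite leq_eqVlt eq_sym (inj_eq val_inj) (negbTE nij) => ltji; exists j, i.
pose r := (j - i)%N.
have hr : (h ^+ r = 1)%g.
  by apply: (mulgI (p i)); rewrite mulg1 /p -mulgA -expgnDr subnKC // ltnW.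
(* The common difference [h] has to belong to the set too. As [h] has finite order, exponents reduce
   modulo [r], within the range of [Xgh]. *)
pose Z := [set z | z = h \/ exists k, z = (g * h ^+ k)%g].
case: (@progression_not_sub Z g h) => [z|||a b|_ [k _ <-]]; last by right; exists k.
- case=> [->//|[k ->]].
  have -> : (h ^+ k = h ^+ (k %% r))%g.
    by rewrite {1}(divn_eq k r) expgnDr mulnC expgnA hr expg1n mul1g.
  apply: Xgh; rewrite ltnW // (leq_trans (ltn_pmod _ _)) ?subn_gt0 //.
  by rewrite leq_subLR (leq_trans _ (leq_addl _ _)) // -ltnS.
- by right; exists 0; rewrite expg0 mulg1.
- by left.
have cghk k : commute h (g * h ^+ k)%g.
  by apply: commuteM; [apply: commute_sym|apply: commuteX].
case=> [->|[k ->]] [->|[l ->]] //; first exact/commute_sym.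
apply: commuteM; last by apply: commuteX; apply: commute_sym.
by apply/commute_sym/commuteM; [|apply: commuteX].
Qed.

Lemma word_nil h w s : (0 < size S)%N -> size s = size S ->
  {in s, forall y, L_ h y} -> word w s = 0.
Proof.
move=> S0 sS Ls.
have /seteqP[_ /(_ w I)] // : [set w | [set 0] (word w s)] = setT.
apply: grading_sum_homog => [|v [g Lv]].
  exact/subspace_preword/subspace_set0.
exact: (word_nil_homog Lv S0 sS Ls).
Qed.

Lemma graded_nilpotent : (0 < size S)%N ->
  nilpotent_class_le L (higman (size S)).
Proof.
move=> S0; apply/seteqP; split=> [x /lower_central_chain Cx|_ ->].
  apply: (homog_chain grading_graded_subalgebra not_support S0 _ L_1_eq0).
  - by move=> g w s sS Ls; apply: word_nil Ls.
  - exact: fset_uniq.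
  exact: (chain_le (higman_bound_gt0 S0)).
case: (higman _) => [|k] //=.
exact: (subspace0 (@subspace_span K L _)).
Qed.

End Grading.

Unset Implicit Arguments.

Local Open Scope fset_scope.

Theorem theorem3p14 (K : fieldType) (L : lieAlgType K) (G : groupType)
    (L_ : G -> set L)
    (L_grading : is_grading L_)
    (support_neq0 : (grading_support L_ !=set0)%classic)
    (support_free : arithmetically_free (grading_support L_)) :
  nilpotent_class_le L (higman #|` fset_set (grading_support L_)|).
Proof.
apply: graded_nilpotent => //.
have [g Xg] := support_neq0; have := mem_support support_free g.
by rewrite (mem_set Xg); case: (enum_fset _).
Qed.
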